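(* Let $\rho(r)$ be a proximate order, $\rho=\lim_{r\to\infty}\rho(r)$, and let $\mu\in\mathfrak M_\infty(\rho(r))$. Suppose that the measure $\mu$ is regular and $Fr[\mu]=\{\nu\}$. Then there is a complex number $c$ such that $d\nu(r)=c\,r^{\rho-1}dr$.
   Context: Proximate orders: a zero proximate order is a real function $\hat\rho(r)$ on $(0,\infty)$ (possibly undefined at $r=1$) such that $\lim_{r\to\infty}\hat\rho(r)=0$; $\hat\rho(1/r)=-\hat\rho(r)$; $\hat\rho$ is continuously differentiable on $(0,\infty)\setminus\{1\}$; $\lim_{r\to\infty}r\ln r\,\hat\rho'(r)=0$; and $r^{\hat\rho(r)}$ extends continuously to $r=1$ with value $1$. A proximate order is $\rho(r)=\rho+\hat\rho(r)$ with $\rho\in\mathbb R$ and $\hat\rho$ a zero proximate order. Put $V(r)=r^{\rho(r)}$. Radon measures: a real Radon measure on $(0,\infty)$ is $\mu=\mu_1-\mu_2$ with $\mu_1,\mu_2$ mutually singular positive Borel measures, finite on compact subsets of $(0,\infty)$; a complex Radon measure is $\mu_1+i\mu_2$ with $\mu_1,\mu_2$ real Radon measures; $|\mu|$ is the total variation. Wide convergence $\mu_n\to\mu$ means $\int\varphi\,d\mu_n\to\int\varphi\,d\mu$ for every continuous $\varphi$ with compact support in $(0,\infty)$. $\mathfrak M_\infty(\rho(r))$ is the set of (complex) Radon measures on $(0,\infty)$ with $\sup_{r\ge1}|\mu|([r,er])/V(r)<\infty$. With $\mu_t(E)=\mu(tE)/V(t)$, the Azarin limit set $Fr[\mu]$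 is the set of all wide limits $\nu=\lim_{n\to\infty}\mu_{t_n}$ with $t_n\to+\infty$. A measure $\mu\in\mathfrak M_\infty(\rho(r))$ is called regular if $Fr[\mu]$ consists of a single measure. *)

(* Defs.v *)
From HB Require Import structures.
From mathcomp Require Import all_boot all_order all_algebra.
From mathcomp Require Import complex.
From mathcomp Require Import all_classical all_reals all_analysis.
From mathcomp Require Import measurable_realfun.

Set Implicit Arguments.
Unset Strict Implicit.
Unset Printing Implicit Defensive.

Import Order.TTheory GRing.Theory Num.Theory.
Import numFieldNormedType.Exports.

Local Open Scope classical_set_scope.
Local Open Scope ring_scope.

(* [rh] is total, so its value at [1] is junk and is never constrained:
   symmetry and regularity are only required off [1], and the last condition
   is a limit at [1] along the punctured neighbourhoods. *)
Record zero_proximate_order (R : realType) (rh : R -> R) : Prop := {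
  zpo_lim : rh r @[r --> +oo] --> (0 : R);
  zpo_inv : forall r : R, 0 < r -> r != 1 -> rh r^-1 = - rh r;
  zpo_derivable : forall r : R, 0 < r -> r != 1 -> derivable rh r 1;
  zpo_continuous_derive :
    forall r : R, 0 < r -> r != 1 -> {for r, continuous (derive1 rh)};
  zpo_lim_derive : r * ln r * derive1 rh r @[r --> +oo] --> (0 : R);
  zpo_at_one : r `^ (rh r) @[r --> (1 : R)^'] --> (1 : R)
}.

Definition proximate_order (R : realType) (rho : R -> R) : Prop :=
  exists (l : R) (rh : R -> R), zero_proximate_order rh /\
    forall r : R, 0 < r -> r != 1 -> rho r = l + rh r.

(* At [r = 1] this is [1] whatever [rho 1] is, which agrees with the
   continuous extension. *)
Definition growth (R : realType) (rho : R -> R) (r : R) : R := r `^ (rho r).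

Lemma growth_gt0 (R : realType) (rho : R -> R) (t : {posnum R}) :
  0 < growth rho t%:num.
Proof. exact: powR_gt0. Qed.

(* A Borel measure on the half-line ]0, +oo[ is encoded as a Borel measure on
   R for which the complement of the half-line is null. *)
Record posRadon (R : realType) := PosRadon {
  prmeas :> {measure set (measurableTypeR R) -> \bar R};
  prmeas_off : prmeas (`]-oo, 0]%classic : set R) = 0%E;
  prmeas_compact : forall K : set R, compact K -> K `<=` `]0, +oo[ ->
    (prmeas K < +oo)%E
}.

Definition mutually_singular (R : realType) (m1 m2 : posRadon R) : Prop :=
  exists A : set (measurableTypeR R),
    [/\ measurable A, m1 A = 0%E & m2 (~` A) = 0%E].

(* The difference of the two parts need not make sense on an unbounded Borel
   set, hence a real Radon measure is kept as the pair of its parts. *)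
Record realRadon (R : realType) := RealRadon {
  rpos : posRadon R;
  rneg : posRadon R;
  rsing : mutually_singular rpos rneg
}.

Record complexRadon (R : realType) := ComplexRadon {
  cre : realRadon R;
  cim : realRadon R
}.

Definition relcompact_borel (R : realType) (E : set R) : Prop :=
  measurable (E : set (measurableTypeR R)) /\
  exists K : set R, [/\ compact K, K `<=` `]0, +oo[ & E `<=` K].

(* Values of Radon measures; only meaningful when [relcompact_borel E]. *)
Definition rval (R : realType) (m : realRadon R) (E : set R) : R :=
  fine (rpos m E) - fine (rneg m E).

Definition cval (R : realType) (mu : complexRadon R) (E : set R) : R[i] :=
  (rval (cre mu) E +i* rval (cim mu) E)%C.

(* Equality of Radon measures: MathComp-Analysis measures are functions on all
   subsets, with arbitrary values on the non-measurable ones, so that Leibniz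
   equality would be too strong. *)
Definition radon_eq (R : realType) (mu nu : complexRadon R) : Prop :=
  forall E, relcompact_borel E -> cval mu E = cval nu E.

(* Finite families and countable partitions give the same supremum, by
   countable additivity. *)
Definition radon_variation (R : realType) (mu : complexRadon R)
    (E : set R) : \bar R :=
  ereal_sup [set s | exists (n : nat) (F : 'I_n -> set R),
    [/\ forall i, relcompact_borel (F i) /\ F i `<=` E,
        trivIset setT F
      & s = (\sum_(i < n) Normc.normc (cval mu (F i)))%:E]].

Definition rint (R : realType) (m : realRadon R) (f : R -> R) : R :=
  \int[rpos m]_(x in `]0, +oo[) f x - \int[rneg m]_(x in `]0, +oo[) f x.

(* (f + i g)(m1 + i m2) = (f m1 - g m2) + i (f m2 + g m1) *)
Definition cint (R : realType) (mu : complexRadon R) (phi : R -> R[i]) : R[i] :=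
  let f x := complex.Re (phi x) in
  let g x := complex.Im (phi x) in
  ((rint (cre mu) f - rint (cim mu) g) +i*
   (rint (cim mu) f + rint (cre mu) g))%C.

(* Continuous functions with compact support in ]0, +oo[, extended by [0] to
   R.  [R[i]^o] is [R[i]] with the topology of its norm. *)
Definition test_function (R : realType) (phi : R -> R[i]^o) : Prop :=
  continuous phi /\
  exists K : set R, [/\ compact K, K `<=` `]0, +oo[ &
    forall x, ~ K x -> phi x = 0].

Definition wide_cvg (R : realType) (mu_ : nat -> complexRadon R)
    (mu : complexRadon R) : Prop :=
  forall phi : R -> R[i]^o, test_function phi ->
    (fun n => cint (mu_ n) phi : R[i]^o) @ \oo --> (cint mu phi : R[i]^o).

(* E |-> m (t E) / v *)
Section dilation.
Context (R : realType) (t v : {posnum R}).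

Let contract (x : measurableTypeR R) : measurableTypeR R := t%:num^-1 * x.

Let measurable_contract : measurable_fun setT contract.
Proof. by apply: continuous_measurable_fun; exact: mulrl_continuous. Qed.

Section measure.
Variable m : {measure set (measurableTypeR R) -> \bar R}.

Definition dilate_fun (E : set (measurableTypeR R)) : \bar R :=
  ((v%:num^-1)%:E * m [set (t%:num * x)%R | x in E])%E.

Let dilate_funE E : dilate_fun E = ((v%:num^-1)%:E * m (contract @^-1` E))%E.
Proof.
congr (_ * m _)%E; apply/seteqP; split => [_ [x Ex <-]|x Ex] /=.
  by rewrite /contract mulKf.
by exists (contract x) => //; rewrite /contract mulVKf.
Qed.

Let dilate_fun0 : dilate_fun set0 = 0%E.
Proof. by rewrite /dilate_fun image_set0 measure0 mule0. Qed.

Let dilate_fun_ge0 E : (0 <= dilate_fun E)%E.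
Proof. by rewrite mule_ge0. Qed.

Let dilate_fun_sigma_additive : semi_sigma_additive dilate_fun.
Proof.
move=> F mF tF mUF.
have mpre A : measurable A -> measurable (contract @^-1` A).
  by move=> mA; rewrite -[X in measurable X]setTI; exact: measurable_contract.
rewrite [X in X @ \oo --> _](_ : _ = (fun n => (v%:num^-1)%:E *
    \sum_(0 <= i < n) m (contract @^-1` (F i)))%E); last first.
  apply/funext => n; rewrite ge0_sume_distrr//.
  by apply: eq_bigr => i _; rewrite dilate_funE.
rewrite dilate_funE preimage_bigcup; apply: cvgeZl => //.
apply: measure_semi_sigma_additive.
- by move=> n; exact: mpre.
- apply/trivIsetP => /= i j _ _ ij; rewrite -preimage_setI.
  by move/trivIsetP : tF => /(_ _ _ _ _ ij) ->//; rewrite preimage_set0.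
- by rewrite -preimage_bigcup; exact: mpre.
Qed.

HB.instance Definition _ := isMeasure.Build _ _ _ dilate_fun
  dilate_fun0 dilate_fun_ge0 dilate_fun_sigma_additive.

End measure.

Let dilate_off (m : posRadon R) : dilate_fun m (`]-oo, 0]%classic : set R) = 0%E.
Proof.
rewrite /dilate_fun (_ : [set _ | _ in _] = (`]-oo, 0]%classic : set R)) ?prmeas_off ?mule0//.
apply/seteqP; split => [_ [x /= x0 <-]|x /= x0].
  by move: x0; rewrite !in_itv/= pmulr_rle0.
exists (t%:num^-1 * x); last by rewrite mulVKf.
by move: x0; rewrite /= !in_itv/= pmulr_rle0.
Qed.

Let dilate_compact (m : posRadon R) (K : set R) :
  compact K -> K `<=` `]0, +oo[ -> (dilate_fun m K < +oo)%E.
Proof.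
move=> cK K0; rewrite /dilate_fun.
suff : (m [set (t%:num * x)%R | x in K] < +oo)%E.
  by move=> h; rewrite lte_mul_pinfty.
apply: prmeas_compact.
  by apply: continuous_compact => //; apply: continuous_subspaceT;
    exact: mulrl_continuous.
move=> _ [x /K0 /= x0 <-]; move: x0.
by rewrite !in_itv/= !andbT => x0; rewrite mulr_gt0.
Qed.

Definition dilate_pos (m : posRadon R) : posRadon R :=
  PosRadon (dilate_off m) (@dilate_compact m).

Let dilate_sing (m : realRadon R) :
  mutually_singular (dilate_pos (rpos m)) (dilate_pos (rneg m)).
Proof.
have [A [mA m1 m2]] := rsing m.
exists [set x | A (t%:num * x)]; split.
- rewrite -[X in measurable X]setTI.
  have mt : measurable_fun setT ( *%R t%:num : measurableTypeR R -> R).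
    by apply: continuous_measurable_fun; exact: mulrl_continuous.
  exact: mt.
- rewrite /= /dilate_fun (_ : [set _ | _ in _] = A) ?m1 ?mule0//.
  apply/seteqP; split => [_ [x /= Ax <-]//|x Ax].
  by exists (t%:num^-1 * x); rewrite /= mulVKf.
- rewrite /= /dilate_fun (_ : [set _ | _ in _] = ~` A) ?m2 ?mule0//.
  apply/seteqP; split => [_ [x /= Ax <-]//|x Ax].
  by exists (t%:num^-1 * x); rewrite /= mulVKf.
Qed.

Definition dilate_real (m : realRadon R) : realRadon R :=
  RealRadon (dilate_sing m).

Definition dilate (mu : complexRadon R) : complexRadon R :=
  ComplexRadon (dilate_real (cre mu)) (dilate_real (cim mu)).

End dilation.

(* [growth rho] is V, and [azarin rho mu t] is E |-> mu (t E) / V t. *)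
Definition azarin (R : realType) (rho : R -> R) (mu : complexRadon R)
    (t : {posnum R}) : complexRadon R :=
  dilate t (PosNum (growth_gt0 rho t)) mu.

Definition M_infty (R : realType) (rho : R -> R) : set (complexRadon R) :=
  [set mu | (ereal_sup
    [set (radon_variation mu `[r, (expR 1 * r)%R] * ((growth rho r)^-1)%:E)%E
      | r in (`[1%R, +oo[%classic : set R)] < +oo)%E].

Definition Fr (R : realType) (rho : R -> R) (mu : complexRadon R) :
    set (complexRadon R) :=
  [set nu | exists t : nat -> {posnum R},
    (t n)%:num @[n --> \oo] --> +oo /\
    wide_cvg (fun n => azarin rho mu (t n)) nu].

(* A = {nu}, for measures considered up to [radon_eq] *)
Definition is_radon_singleton (R : realType) (A : set (complexRadon R))
    (nu : complexRadon R) : Prop :=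
  A nu /\ forall nu', A nu' -> radon_eq nu' nu.

Definition regular (R : realType) (rho : R -> R) (mu : complexRadon R) : Prop :=
  M_infty rho mu /\ exists nu, is_radon_singleton (Fr rho mu) nu.

(* d nu = c r^a dr on ]0, +oo[ *)
Definition has_power_density (R : realType) (nu : complexRadon R) (c : R[i])
    (a : R) : Prop :=
  forall E : set R, relcompact_borel E ->
    cval nu E = c * (\int[lebesgue_measure]_(r in E) (r `^ a))%:C%C.

(* Main.v *)
From HB Require Import structures.
Require Import Defs.
From mathcomp Require Import all_boot all_order all_algebra.
From mathcomp Require Import complex.
From mathcomp Require Import all_classical all_reals all_analysis.
From mathcomp Require Import measurable_realfun lra ring.
Import Order.TTheory GRing.Theory Num.Theory.
Import numFieldNormedType.Exports.
Local Open Scope classical_set_scope.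
Local Open Scope ring_scope.

(** The limit set [Fr mu] is invariant under the maps sending [nu] to
    [E |-> nu (t E) / t^rho0], for every [t > 0]: if [nu] is the limit of the
    rescaled measures along a sequence [s n], the image is the limit along
    [t * s n], because [V (t r) / V r] tends to [t^rho0] as [r] tends to infinity
    ([growth_slowly_varying], [Fr_scale]). When [Fr mu] is reduced to [nu], this
    forces [nu (t E) = t^rho0 * nu E] for all [t > 0].

    A homogeneous measure of degree [a] has density [c * r^(a - 1)]
    ([homogeneous_power_density]). By homogeneity its values on intervals are
    determined by the function [G] sending [x] to the value of [nu] on ]1, x],
    which satisfies [G (x y) = G x + x^a * G y]. For [a] nonzero the symmetry in [x] and [y] gives
    that [G x] is proportional to [x^a - 1]; for [a = 0] this is Cauchy's
    equation, and since [G] is locally bounded it is proportional to [ln x]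
    ([cocycle_primitive]). In both cases [G] is [c] times the primitive of
    [r^(a - 1)] vanishing at [1], so that [nu] and the measure [c * r^(a - 1) dr]
    agree on intervals, hence on all relatively compact Borel sets
    ([rval_density_itv]). *)

(** * Slow variation of a proximate order *)

Section growth.
Context {R : realType}.
Implicit Types (k dk rh rho : R -> R) (a l : R).

(** On an interval of fixed length [|a|] far away, the mean value theorem bounds
    the increment of [k] by [|a|] times a small derivative. *)
Lemma cvg_increment k dk a :
  (\forall x \near +oo, is_derive (x : R) (1 : R) k (dk x)) ->
  dk x @[x --> +oo] --> (0 : R) ->
  k (x + a) - k x @[x --> +oo] --> (0 : R).
Proof.
move=> [A [_ kA]] dk0; apply/cvgrPdist_lt => e e0.
(* [|a| + 1] rather than [|a|] keeps the bound meaningful when [a = 0]. *)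
have ea0 : 0 < e / (`|a| + 1) by rewrite divr_gt0// ltr_wpDl.
move/cvgrPdist_lt : dk0 => /(_ _ ea0) [B [_ dkB]].
have kxy x y : Num.max A B < x -> x <= y ->
    `|k y - k x| <= e / (`|a| + 1) * (y - x).
  rewrite gt_max => /andP[Ax Bx] xy.
  have dkx z : x <= z -> is_derive z 1 k (dk z).
    by move=> xz; apply: kA; exact: lt_le_trans xz.
  have [||c cxy ->] := @MVT_segment R k dk x y xy.
  - by move=> z; rewrite in_itv/= => /andP[xz _]; apply: dkx; exact: ltW.
  - apply: derivable_within_continuous => z; rewrite in_itv/= => /andP[xz _].
    by have := dkx _ xz; move/@ex_derive.
  - rewrite normrM (ger0_norm (_ : 0 <= y - x)) ?subr_ge0//.
    rewrite ler_wpM2r ?subr_ge0//.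
    move: cxy; rewrite in_itv/= => /andP[xc _].
    by have := dkB c (lt_le_trans Bx xc); rewrite sub0r normrN => /ltW.
have ea : e / (`|a| + 1) * `|a| < e.
  by rewrite -mulrA gtr_pMr// mulrC ltr_pdivrMr ?mul1r ?ltrDl// ltr_wpDl.
near=> x; rewrite sub0r normrN.
have xAB : Num.max A B < x.
  by near: x; apply: nbhs_pinfty_gt; rewrite num_real.
have xaAB : Num.max A B < x + a.
  by rewrite -ltrBlDr; near: x; apply: nbhs_pinfty_gt; rewrite num_real.
apply: le_lt_trans ea.
have [a0|a0] := leP 0 a.
  by rewrite (le_trans (kxy _ _ xAB _)) ?lerDl// addrAC subrr add0r ger0_norm.
rewrite distrC (le_trans (kxy _ _ xaAB _))//; first by rewrite gerDl ltW.
by rewrite opprD addrA subrr add0r ltr0_norm.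
Unshelve. all: by end_near. Qed.

Lemma cvgry_expR : expR x @[x --> +oo] --> (+oo : set_system R).
Proof.
apply/cvgryPge => A; near=> x; rewrite (@le_trans _ _ (1 + x)) ?expR_ge1Dx//.
by rewrite -lerBlDl; near: x; apply: nbhs_pinfty_ge; rewrite num_real.
Unshelve. all: by end_near. Qed.

Lemma cvgry_ln : ln x @[x --> +oo] --> (+oo : set_system R).
Proof.
apply/cvgryPge => A; near=> x; rewrite -ler_expR lnK.
  by near: x; apply: nbhs_pinfty_ge; rewrite num_real.
by rewrite posrE; near: x; apply: nbhs_pinfty_gt; rewrite num_real.
Unshelve. all: by end_near. Qed.

(** At [s = 0] the value of [rho] is arbitrary, but both sides are [1]. *)
Lemma growth_expR rho l rh (s : R) :
  (forall r : R, 0 < r -> r != 1 -> rho r = l + rh r) ->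
  growth rho (expR s) = expR (l * s + rh (expR s) * s).
Proof.
move=> rhoE; rewrite /growth /powR gt_eqF ?expR_gt0// expRK.
have [->|s0] := eqVneq s 0; first by rewrite !mulr0 addr0.
by rewrite rhoE ?expR_gt0// ?mulrDl// -expR0 (inj_eq (@expR_inj R)).
Qed.

(** The function [V] is regularly varying of index [rho0]. With
    [k s = s * rh (exp s)] the logarithm of the ratio at [t = exp s] is
    [- rho0 * ln lam - (k (s + ln lam) - k s)]. The derivative of [k] at [ln r] is
    [r * ln r * rh' r + rh r], and the decay conditions in the definition of a
    zero proximate order make both terms tend to [0], so that the increment of
    [k] vanishes at infinity. *)
Lemma growth_slowly_varying rho (rho0 lam : R) :
  proximate_order rho -> rho r @[r --> +oo] --> rho0 -> 0 < lam ->
  growth rho t / growth rho (lam * t) @[t --> +oo] --> lam `^ (- rho0).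
Proof.
move=> [l [rh [zrh rhoE]]] rho0E lam0.
have <- : l = rho0.
  have : l + rh r @[r --> +oo] --> l + 0.
    by apply: cvgD; [exact: cvg_cst|exact: zpo_lim zrh].
  rewrite addr0 => lE; apply: cvg_unique rho0E => //.
  apply: cvg_trans lE; apply: near_eq_cvg; near=> r; apply: esym; apply: rhoE.
    by near: r; apply: nbhs_pinfty_gt; rewrite num_real.
  by rewrite gt_eqF//; near: r; apply: nbhs_pinfty_gt; rewrite num_real.
pose k (s : R) := rh (expR s) * s.
pose dk (s : R) := expR s * s * derive1 rh (expR s) + rh (expR s).
have dkE (s : R) : 0 < s -> is_derive (s : R) (1 : R) k (dk s).
  move=> s0; rewrite /k /dk.
  have drh : is_derive (expR s : R) (1 : R) rh (derive1 rh (expR s)).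
    rewrite derive1E; apply: derivableP; apply: (zpo_derivable zrh).
      exact: expR_gt0.
    by rewrite gt_eqF// -expR0 ltr_expR.
  have := is_deriveM (is_derive1_comp drh (is_derive_expR s)) (is_derive_id s (1 : R)).
  move=> H; apply: is_derive_eq H _.
  by rewrite /= /GRing.scale/=; ring.
have dk0 : dk s @[s --> +oo] --> (0 : R).
  rewrite -[X in _ --> X](addr0 (0 : R)); apply: cvgD.
    have := cvg_comp _ _ cvgry_expR (zpo_lim_derive zrh).
    apply: cvg_trans; apply: near_eq_cvg; near=> s => /=.
    by rewrite expRK.
  exact: (cvg_comp _ _ cvgry_expR (zpo_lim zrh)).
have : k (s + ln lam) - k s @[s --> +oo] --> (0 : R).
  by apply: (cvg_increment _ _ _ _ dk0); near=> s; apply: dkE.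
move/(cvg_comp _ _ cvgry_ln) => kk.
have -> : lam `^ (- l) = expR (- (l * ln lam) - 0).
  by rewrite subr0 /powR gt_eqF// mulNr.
have : expR (- (l * ln lam) - (k (ln t + ln lam) - k (ln t))) @[t --> +oo]
    --> expR (- (l * ln lam) - 0).
  apply: continuous_cvg; first exact: continuous_expR.
  by apply: cvgB; [exact: cvg_cst|exact: kk].
apply: cvg_trans; apply: near_eq_cvg; near=> t.
have t0 : 0 < t by near: t; apply: nbhs_pinfty_gt; rewrite num_real.
have -> : growth rho t = growth rho (expR (ln t)) by rewrite lnK.
have -> : growth rho (lam * t) = growth rho (expR (ln t + ln lam)).
  by rewrite expRD !lnK// mulrC.
rewrite !(growth_expR _ _ _ _ rhoE) -expRN -expRD /k; congr expR.
by rewrite mulrDr; ring.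
Unshelve. all: by end_near. Qed.

End growth.

(** * The cocycle equation [G (x y) = G x + x^a G y] *)

Section cocycle.
Context {R : realType}.

(** The primitive of [r^(a - 1)] that vanishes at [1]. *)
Definition power_primitive (a x : R) : R :=
  if a == 0 then ln x else (x `^ a - 1) / a.

(** Cauchy's functional equation under local boundedness. The defect
    [h s = G (exp s) - s * G e] is additive and vanishes at [1], hence at every
    natural number, so that its values on the half-line are those it takes
    between [0] and [1]: it is bounded. Since [h (n s) = n * h s], it must vanish. *)
Lemma cocycle_log (G : R -> R) (M : R) :
  (forall x y, 1 <= x -> 1 <= y -> G (x * y) = G x + G y) ->
  (forall x, 1 <= x -> x <= expR 1 -> `|G x| <= M) ->
  forall x, 1 <= x -> G x = G (expR 1) * ln x.
Proof.
move=> GM GB.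
have G1 : G 1 = 0.
  by have := GM 1 1 (lexx _) (lexx _); rewrite mulr1; lra.
have ge1 s : 0 <= s -> 1 <= expR s :> R by move=> s0; rewrite -expR0 ler_expR.
pose h s := G (expR s) - s * G (expR 1).
have hD s t : 0 <= s -> 0 <= t -> h (s + t) = h s + h t.
  by move=> s0 t0; rewrite /h expRD GM ?ge1//; ring.
have hX n s : 0 <= s -> h (n%:R * s) = n%:R * h s.
  move=> s0; elim: n => [|n ih].
    by rewrite !mul0r /h expR0 G1; ring.
  by rewrite -natr1 !mulrDl !mul1r hD ?mulr_ge0// ih.
have h1 : h 1 = 0 by rewrite /h; ring.
have hB s : 0 <= s -> s <= 1 -> `|h s| <= M + `|G (expR 1)|.
  move=> s0 s1; rewrite (le_trans (ler_normB _ _))// lerD//.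
    by rewrite GB ?ge1// ler_expR.
  by rewrite normrM ger0_norm// ler_piMl.
have hB' s : 0 <= s -> `|h s| <= M + `|G (expR 1)|.
  move=> s0; have /andP[ns sn] := truncn_itv s0.
  (* Only the fractional part of [s] contributes. *)
  rewrite -(subrKC (Num.truncn s)%:R s) hD ?subr_ge0//.
  rewrite -[X in h X]mulr1 hX// h1 mulr0 add0r hB ?subr_ge0//.
  by rewrite lerBlDl natr1 ltW.
have h0 s : 0 <= s -> h s = 0.
  move=> s0; apply/eqP; rewrite -normr_eq0 -[_ == _]negbK; apply/negP => hs.
  have hs0 : 0 < `|h s| by rewrite lt_neqAle eq_sym hs normr_ge0.
  have B0 : 0 <= M + `|G (expR 1)| by exact: le_trans (hB' _ s0).
  (* A multiple of [s] at which the bound on [h] is exceeded. *)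
  have := hB' _ (mulr_ge0 (ler0n R (Num.truncn ((M + `|G (expR 1)|) / `|h s|)).+1) s0).
  rewrite hX// normrM normr_nat leNgt -ltr_pdivrMr//.
  by have /andP[_ ->] := truncn_itv (divr_ge0 B0 (ltW hs0)).
move=> x x1; have x0 : 0 < x by exact: lt_le_trans x1.
have := h0 _ (ln_ge0 x1); rewrite /h lnK// mulrC => /eqP.
by rewrite subr_eq0 => /eqP.
Qed.

(** For a nonzero exponent the equation alone determines [G] up to a factor:
    expanding [G (2 * x)] and [G (x * 2)] gives
    [G x * (2^a - 1) = G 2 * (x^a - 1)]. *)
Lemma cocycle_power (a : R) (G : R -> R) : a != 0 ->
  (forall x y, 1 <= x -> 1 <= y -> G (x * y) = G x + x `^ a * G y) ->
  forall x, 1 <= x -> G x = G 2 / (2 `^ a - 1) * (x `^ a - 1).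
Proof.
move=> a0 GM x x1.
have a2 : 2 `^ a - 1 != 0 :> R.
  by rewrite subr_eq0 powR_eq1 pnatr_eq1 ltNge ler0n.
have := GM _ _ x1 (ler1n R 2); rewrite mulrC GM ?ler1n// => e.
by apply: (mulIf a2); rewrite mulrAC divfK//; lra.
Qed.

Lemma cocycle_primitive (a : R) (G : R -> R) (M : R) :
  (forall x y, 1 <= x -> 1 <= y -> G (x * y) = G x + x `^ a * G y) ->
  (forall x, 1 <= x -> x <= expR 1 -> `|G x| <= M) ->
  exists c, forall x, 1 <= x -> G x = c * power_primitive a x.
Proof.
rewrite /power_primitive => GM GB; have [a0|a0] := eqVneq a 0.
  exists (G (expR 1)); apply: (cocycle_log _ M) => // x y x1 y1.
  by rewrite GM// a0 powRr0 mul1r.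
exists (G 2 / (2 `^ a - 1) * a) => x x1.
by rewrite [_ / a]mulrC mulrA mulfK//; apply: cocycle_power.
Qed.

Lemma power_primitive_scale (a x y : R) : 0 < x -> 0 < y ->
  x `^ a * power_primitive a (y / x) = power_primitive a y - power_primitive a x.
Proof.
move=> x0 y0; rewrite /power_primitive; have [->|a0] := eqVneq a 0.
  by rewrite powRr0 mul1r ln_div.
rewrite powRM ?invr_ge0 ?ltW// -powR_inv1 ?ltW// -powRrM mulN1r powRN.
by field; rewrite a0/= gt_eqF ?powR_gt0.
Qed.

Lemma is_derive_power_primitive (a x : R) : 0 < x ->
  is_derive (x : R) (1 : R) (power_primitive a) (x `^ (a - 1)).
Proof.
move=> x0; rewrite /power_primitive; have [->|a0] := eqVneq a 0.
  by rewrite sub0r powR_inv1 ?ltW//; exact: is_derive1_ln.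
have xa := is_derive1_powR a x0.
have -> : (fun y : R => (y `^ a - 1) / a) = a^-1 \*: ((fun y : R => y `^ a) - cst 1).
  by apply/funext => y; rewrite /= /GRing.scale/= mulrC.
have -> : x `^ (a - 1) = a^-1 *: (a * x `^ (a - 1) - 0).
  by rewrite subr0 /GRing.scale/= mulKf.
by apply: is_deriveZ; apply: is_deriveB.
Qed.

Lemma integral_power (a x y : R) : 0 < x -> x <= y ->
  (\int[lebesgue_measure]_(r in `]x, y]) (r `^ (a - 1))%:E =
   (power_primitive a y - power_primitive a x)%:E)%E.
Proof.
move=> x0; rewrite le_eqVlt => /predU1P[<-|xy].
  by rewrite set_itv_ge ?bnd_simp ?ltxx// integral_set0 subrr.
have dP z : x <= z -> is_derive (z : R) (1 : R) (power_primitive a) (z `^ (a - 1)).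
  by move=> xz; apply: is_derive_power_primitive; exact: lt_le_trans xz.
have cP z : x <= z -> {for z, continuous (power_primitive a)}.
  by move=> /dP [dz _]; apply: differentiable_continuous; exact/derivable1_diffP.
rewrite integral_itv_obnd_cbnd; last first.
  by apply/measurable_EFinP; apply: measurable_funTS; exact: measurable_powR.
rewrite (continuous_FTC2 (F := power_primitive a))//.
- apply: derivable_within_continuous => z; rewrite in_itv/= => /andP[xz _].
  by apply: ex_derive; apply: is_derive1_powR; exact: lt_le_trans xz.
- split.
  + by move=> z; rewrite in_itv/= => /andP[/ltW/dP[]].
  + by apply: cvg_at_right_filter; exact: cP.
  + by apply: cvg_at_left_filter; apply: cP; exact: ltW.
- move=> z; rewrite in_itv/= => /andP[/ltW/dP[_ <-]] _.
  by rewrite derive1E.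
Qed.

End cocycle.

(** * Radon measures on the half-line and their values on intervals *)

Section density.
Context d (T : measurableType d) {R : realType}.

Lemma exists_density_measure (m : {measure set T -> \bar R}) (f : T -> \bar R) :
  measurable_fun setT f -> (forall x, 0 <= f x)%E ->
  exists m' : {measure set T -> \bar R},
    forall E, m' E = (\int[m]_(x in E) f x)%E.
Proof.
move=> mf f0; pose m' E := (\int[m]_(x in E) f x)%E.
have m'0 : m' set0 = 0%E by exact: integral_set0.
have m'_ge0 E : (0 <= m' E)%E by apply: integral_ge0 => x _; exact: f0.
have m'_sigma : semi_sigma_additive m'.
  move=> F mF tF mUF; rewrite /m' ge0_integral_bigcup//; last first.
    exact: measurable_funTS.
  by apply: is_cvg_ereal_nneg_natsum_cond => n _ _; exact: m'_ge0.
pose mix := isMeasure.Build d T R m' m'0 m'_ge0 m'_sigma.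
by pose M : {measure set T -> \bar R} := HB.pack m' mix; exists M.
Qed.

End density.

Section radon_values.
Context {R : realType}.
Implicit Types (m : realRadon R) (p q : posRadon R) (E : set R) (a b c : R).

Lemma relcompact_borel_itv a b : 0 < a -> relcompact_borel `]a, b].
Proof.
move=> a0; split; first exact: measurable_itv.
exists `[a, b]%classic; split; [exact: segment_compact| |exact: subset_itv_oc_cc].
by move=> x /=; rewrite !in_itv/= andbT => /andP[/(lt_le_trans a0)].
Qed.

Lemma relcompact_borel_bound E : relcompact_borel E ->
  exists a b, [/\ 0 < a, a <= b & E `<=` `]a, b]].
Proof.
move=> [mE [K [cK K0 EK]]].
have [K_0|/set0P K_n0] := eqVneq K set0.
  exists 1, 1; split => //.
  by move: EK; rewrite K_0 => /subset_trans; apply.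
have cid := @continuous_subspaceT _ _ K (@idfun R) (fun=> cvg_id).
have [x Kx xK] := compact_EVT_min K_n0 cK cid.
have [y Ky yK] := compact_EVT_max K_n0 cK cid.
rewrite inE in Kx.
have x0 : 0 < x by have := K0 _ Kx; rewrite /= in_itv/= andbT.
(* The left endpoint is excluded, so it must lie below the minimum [x]. *)
exists (x / 2), y; split.
- by rewrite divr_gt0.
- have xy : x <= y by apply: yK; rewrite inE.
  by rewrite (le_trans _ xy)// ler_pdivrMr// ler_peMr ?ler1n// ltW.
- move=> z /EK Kz; have zy : z <= y by apply: yK; rewrite inE.
  rewrite /= in_itv/= zy andbT.
  have xz : x <= z by apply: xK; rewrite inE.
  by rewrite (lt_le_trans _ xz)// ltr_pdivrMr// ltr_pMr// ltr1n.
Qed.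

Lemma posRadon_fin p E : relcompact_borel E -> p E \is a fin_num.
Proof.
move=> [mE [K [cK K0 EK]]]; rewrite ge0_fin_numE ?measure_ge0//.
rewrite (@le_lt_trans _ _ (p K) _ _ _ (prmeas_compact p cK K0))// le_measure// inE//.
exact: compact_measurable.
Qed.

(** The measure uniqueness theorem applies to positive measures only, so the
    negative parts are moved to the other side: with [c = cp - cn], the equality
    [pos - neg = c L] becomes [pos + cn L = neg + cp L], restricted to an interval
    [D] containing [E] on which everything is finite. Half-open intervals form a
    generating family stable under intersection. *)
Lemma rval_density_itv m (c a : R) E :
  (forall x y, 0 < x -> x <= y ->
     rval m `]x, y] =
     c * \int[lebesgue_measure]_(r in `]x, y]) (r `^ (a - 1))) ->
  relcompact_borel E ->
  rval m E = c * \int[lebesgue_measure]_(r in E) (r `^ (a - 1)).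
Proof.
move=> mI rE; have [a0 [b0 [a0_gt0 ab0 Eab]]] := relcompact_borel_bound _ rE.
pose D : set (measurableTypeR R) := `]a0, b0]%classic.
have mD : measurable D by exact: measurable_itv.
have [L LE] := @exists_density_measure _ (measurableTypeR R) R lebesgue_measure
  (fun r => (r `^ (a - 1))%:E)
  (proj2 (measurable_EFinP _ _) (@measurable_powR R (a - 1)))
  (fun r => powR_ge0 _ _).
rewrite /Rintegral -LE.
have LD : L D \is a fin_num by rewrite LE integral_power.
have finL F : measurable F -> F `<=` D -> L F \is a fin_num.
  move=> mF FD; rewrite ge0_fin_numE ?measure_ge0//.
  by rewrite (@le_lt_trans _ _ (L D)) ?le_measure ?inE// -ge0_fin_numE.
have finp p F : measurable F -> F `<=` D -> p F \is a fin_num.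
  move=> mF FD; apply: posRadon_fin; split=> //.
  exists `[a0, b0]%classic; split; first exact: segment_compact.
    by move=> x /=; rewrite !in_itv/= andbT => /andP[/(lt_le_trans a0_gt0)].
  by apply: (subset_trans FD); exact: subset_itv_oc_cc.
have [cp [cn cE]] : exists cp cn : {nonneg R}, cp%:num - cn%:num = c.
  have cp0 : 0 <= Num.max c 0 by rewrite le_max lexx orbT.
  have cn0 : 0 <= Num.max (- c) 0 by rewrite le_max lexx orbT.
  exists (NngNum cp0), (NngNum cn0) => /=.
  have [c0|c0] := leP 0 c.
    by rewrite (max_idPr _) ?oppr_le0// subr0.
  by rewrite (max_idPl _) ?oppr_ge0 ?ltW// sub0r opprK.
pose M1 := mrestr (measure_add (rpos m) (mscale cn L)) mD.
pose M2 := mrestr (measure_add (rneg m) (mscale cp L)) mD.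
have M12 F : measurable F -> F `<=` D ->
    M1 F = M2 F <-> rval m F = c * fine (L F).
  move=> mF FD; rewrite /M1 /M2 /mrestr/= (setIidl FD) !measure_addE /= /mscale /=.
  rewrite /rval -(fineK (finp (rpos m) F mF FD)) -(fineK (finp (rneg m) F mF FD)).
  rewrite -(fineK (finL F mF FD)) -!EFinM -!EFinD/= -cE; split.
    by move=> [h]; lra.
  by move=> h; congr EFin; lra.
apply/M12 => //; first by case: rE.
apply: (@measure_unique _ R (measurableTypeR R) (@ocitv R)
  (fun n => `](- n%:R), n%:R]%classic)) => //.
- exact: ocitvI.
- by move=> n; exact: is_ocitv.
- exact: (@bigcup_itvT R false false).
- move=> _ [[x y] _ <-]/=.
  have mI_D (M : set (measurableTypeR R) -> \bar R) X :
    mrestr M mD X = mrestr M mD (X `&` D) by rewrite /mrestr -setIA setIid.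
  rewrite [LHS]mI_D [RHS]mI_D.
  have -> : `]x, y]%classic `&` D = `]Num.max x a0, Num.min y b0]%classic.
    rewrite /D; apply/seteqP; split => z /=; rewrite !in_itv/= gt_max le_min.
      by move=> [/andP[xz zy] /andP[az zb]]; rewrite xz zy az zb.
    by move=> /andP[/andP[xz az] /andP[zy zb]]; rewrite xz zy az zb.
  have [le_xy|lt_yx] := leP (Num.max x a0) (Num.min y b0); last first.
    by rewrite set_itv_ge ?bnd_simp -?leNgt 1?ltW// /M1 /M2 !measure0.
  apply/M12; first exact: measurable_itv.
    by apply: subset_itv; rewrite bnd_simp ?le_max ?ge_min lexx orbT.
  by rewrite LE; apply: mI => //; rewrite lt_max a0_gt0 orbT.
- move=> n; rewrite /M1/= /mrestr.
  rewrite (@le_lt_trans _ _ (measure_add (rpos m) (mscale cn L) D))//.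
    by rewrite le_measure ?inE//; exact: measurableI.
  rewrite measure_addE /= /mscale /= lte_add_pinfty//.
    by rewrite ltey_eq finp.
  by rewrite lte_mul_pinfty// ltey_eq LD.
- by case: rE.
Qed.

End radon_values.

(** * Dilations of Radon measures *)

Section dilation.
Context {R : realType}.
Implicit Types (t v : {posnum R}) (p : posRadon R) (m : realRadon R).

Lemma measurable_scale (c : R) :
  measurable_fun setT (fun x => c * x : measurableTypeR R).
Proof. by apply: continuous_measurable_fun; exact: mulrl_continuous. Qed.

(** Up to the factor [1 / v], the dilated measure is the image of [p] under
    [x |-> x / t]. *)
Lemma ge0_integral_dilate t v p (f : R -> \bar R) :
  measurable_fun setT f -> (forall x, 0 <= f x)%E ->
  (\int[dilate_pos t v p]_(x in `]0%R, +oo[) f x =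
   (v%:num^-1)%:E * \int[p]_(x in `]0%R, +oo[) f (t%:num^-1 * x)%R)%E.
Proof.
move=> mf f0.
pose contract : measurableTypeR R -> measurableTypeR R := fun x => t%:num^-1 * x.
pose cmix := isMeasurableFun.Build _ _ _ _ contract (measurable_scale t%:num^-1).
pose ctr : {mfun measurableTypeR R >-> measurableTypeR R} := HB.pack contract cmix.
have v0 : 0 <= v%:num^-1 by [].
rewrite (eq_measure_integral (mscale (NngNum v0) (pushforward p ctr))); last first.
  move=> A mA _; rewrite /= /dilate_fun /mscale/= /pushforward.
  congr (_ * p _)%E; apply/seteqP; split => [_ [x Ex <-]|x Ex] /=.
    by rewrite /contract mulKf.
  by exists (contract x) => //; rewrite /contract mulVKf.
have mI : measurable (`]0, +oo[%classic : set (measurableTypeR R)).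
  exact: measurable_itv.
rewrite ge0_integral_mscale//; last exact: measurable_funTS.
rewrite ge0_integral_pushforward//; last exact: measurable_funTS.
congr (_ * integral _ _ _)%E; apply/seteqP; split => x /=;
  by rewrite !in_itv/= !andbT pmulr_rgt0.
Qed.

(** Holds also at the infinities, because [fine] sends both of them to [0]; thus
    the change of variables below covers every measurable function. *)
Lemma fineZ (r : R) (x : \bar R) : fine (r%:E * x)%E = r * fine x.
Proof.
case: x => [x| |]//=; rewrite mulr0.
- by rewrite mulry; case: sgrP => _; rewrite ?mul0e ?mul1e ?mulN1e.
- by rewrite mulrNy; case: sgrP => _; rewrite ?mul0e ?mul1e ?mulN1e.
Qed.

(** For a positive factor, distributivity extends to the difference of two equal
    infinities, which is [-oo] by convention and is mapped to itself. *)
Lemma pmuleBr (r : R) (x y : \bar R) : 0 < r ->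
  (r%:E * (x - y) = r%:E * x - r%:E * y)%E.
Proof.
move=> r0; case: x y => [x| |] [y| |] //=;
  rewrite ?oppeK ?(gt0_muley, gt0_muleNy) ?lte_fin//.
by rewrite -!EFinM -!EFinB mulrBr.
Qed.

Lemma Rintegral_dilate t v p (f : R -> R) : measurable_fun setT f ->
  \int[dilate_pos t v p]_(x in `]0, +oo[) f x =
  v%:num^-1 * \int[p]_(x in `]0, +oo[) f (t%:num^-1 * x).
Proof.
move=> mf; rewrite /Rintegral integralE [in RHS]integralE.
rewrite !ge0_integral_dilate//; first last.
- by apply: measurable_funepos; apply/measurable_EFinP.
- by apply: measurable_funeneg; apply/measurable_EFinP.
rewrite -fineZ; congr fine.
rewrite [RHS]pmuleBr//; congr (_ * _ - _ * _)%E.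
  by apply: eq_integral => x _; rewrite !funeposE.
by apply: eq_integral => x _; rewrite !funenegE.
Qed.

Lemma rint_dilate t v m (f : R -> R) : measurable_fun setT f ->
  rint (dilate_real t v m) f = v%:num^-1 * rint m (fun x => f (t%:num^-1 * x)).
Proof.
move=> mf; rewrite /rint mulrBr /=.
by rewrite !Rintegral_dilate.
Qed.

Lemma continuous_Re : continuous (@complex.Re R : R[i]^o -> R).
Proof.
move=> z; have Fz : Filter (nbhs z) by exact: (@nbhs_filter R[i]^o).
apply/cvgrPdist_lt => e e0.
apply/(@nbhs_ballP R[i] R[i]^o); exists (e%:C)%C; first by rewrite /= ltcR.
move=> w zw; rewrite -ltcR -raddfB.
exact: le_lt_trans (normc_ge_Re _) zw.
Qed.

Lemma continuous_Im : continuous (@complex.Im R : R[i]^o -> R).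
Proof.
move=> z; have Fz : Filter (nbhs z) by exact: (@nbhs_filter R[i]^o).
apply/cvgrPdist_lt => e e0.
apply/(@nbhs_ballP R[i] R[i]^o); exists (e%:C)%C; first by rewrite /= ltcR.
move=> w zw; rewrite -ltcR -raddfB -normrN -ReiNIm.
apply: le_lt_trans (normc_ge_Re _) _.
by rewrite normrM normCi mulr1.
Qed.

Lemma cval_dilate t v (mu : complexRadon R) (E : set R) :
  cval (dilate t v mu) E =
  ((v%:num^-1)%:C * cval mu [set t%:num * x | x in E]%R)%C.
Proof.
rewrite /cval /rval /= /dilate_fun.
rewrite !fineZ -!mulrBr.
by simpc.
Qed.

Lemma cint_dilate t v (mu : complexRadon R) (phi : R -> R[i]^o) : continuous phi ->
  cint (dilate t v mu) phi =
  ((v%:num^-1)%:C * cint mu (fun x => phi (t%:num^-1 * x)%R))%C.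
Proof.
move=> cphi.
have [mRe mIm] : measurable_fun setT (fun x => complex.Re (phi x)) /\
 measurable_fun setT (fun x => complex.Im (phi x)).
  split; apply: continuous_measurable_fun => x.
    exact: (cvg_comp _ _ (cphi x) (continuous_Re _)).
  exact: (cvg_comp _ _ (cphi x) (continuous_Im _)).
by rewrite /cint /= !rint_dilate// -!mulrBr -!mulrDr; simpc.
Qed.

End dilation.

(** * Homogeneous Radon measures have a power density *)

Section homogeneous.
Context {R : realType}.
Implicit Types (m : realRadon R) (p : posRadon R) (nu : complexRadon R).

Lemma image_scale_itv (t x y : R) : 0 < t ->
  [set t * z | z in `]x, y]]%R = `]t * x, t * y]%classic.
Proof.
move=> t0; apply/seteqP; split => [_ [z + <-]|z] /=; rewrite !in_itv/=.
  by rewrite ltr_pM2l// ler_pM2l.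
rewrite -ltr_pdivlMl// -ler_pdivrMl// => zxy.
by exists (t^-1 * z); [rewrite in_itv|rewrite mulVKf// gt_eqF].
Qed.

Lemma rval_itv_cat m (x y z : R) : 0 < x -> x <= y -> y <= z ->
  rval m `]x, z] = rval m `]x, y] + rval m `]y, z].
Proof.
move=> x0 xy yz; have y0 := lt_le_trans x0 xy.
have pE p : fine (p `]x, z]%classic) =
    fine (p `]x, y]%classic) + fine (p `]y, z]%classic).
  rewrite -fineD; try by apply: posRadon_fin; exact: relcompact_borel_itv.
  rewrite -measureU//=; first 1 last.
  - apply/seteqP; split => // u /=; rewrite !in_itv/= => -[/andP[_ uy] /andP[yu _]].
    by move: (lt_le_trans yu uy); rewrite ltxx.
  - by rewrite -itv_bndbnd_setU ?bnd_simp.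
by rewrite /rval !pE; ring.
Qed.

Lemma rval_itv_le m (x y z : R) : 0 < x -> y <= z ->
  `|rval m `]x, y]| <= fine (rpos m `]x, z]%classic) + fine (rneg m `]x, z]%classic).
Proof.
move=> x0 yz.
have pE p : `|fine (p `]x, y]%classic)| <= fine (p `]x, z]%classic).
  rewrite ger0_norm ?fine_ge0 ?measure_ge0//.
  apply: fine_le; try by apply: posRadon_fin; exact: relcompact_borel_itv.
  by apply: le_measure; rewrite ?inE//; apply: subset_itvl; rewrite bnd_simp.
by rewrite /rval (le_trans (ler_normB _ _))// lerD.
Qed.

(** Let G(x) be the value of [m] on ]1, x]. Cutting ]1, xy] at [x] and rescaling
    the second piece ]x, xy] to ]1, y] shows that G satisfies the cocycle
    equation; on [1, e] it is bounded by the total mass of ]1, e]. Hence G is a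
    multiple of the primitive of [r^(a - 1)], which determines [m] on
    intervals. *)
Lemma homogeneous_density (a : R) m :
  (forall t E, 0 < t -> relcompact_borel E ->
     rval m [set t * x | x in E]%R = t `^ a * rval m E) ->
  exists c, forall E, relcompact_borel E ->
    rval m E = c * \int[lebesgue_measure]_(r in E) (r `^ (a - 1)).
Proof.
move=> hom; pose G x := rval m `]1, x].
have homG x y : 0 < x -> 0 < y -> rval m `]x, y] = x `^ a * G (y / x).
  move=> x0 y0; rewrite -hom//; last exact: relcompact_borel_itv.
  by rewrite image_scale_itv// mulr1 mulrC divfK// gt_eqF.
have GM x y : 1 <= x -> 1 <= y -> G (x * y) = G x + x `^ a * G y.
  move=> x1 y1; have x0 : 0 < x by exact: lt_le_trans x1.
  rewrite /G (rval_itv_cat m 1 x)// ?ler_peMr// ?(ltW x0)//.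
  rewrite (homG x (x * y))//; last by rewrite mulr_gt0// (lt_le_trans _ y1).
  by rewrite [x * y]mulrC mulfK// gt_eqF.
have GB x : 1 <= x -> x <= expR 1 -> `|G x| <= _ :=
    fun _ xe => rval_itv_le m 1 x _ ltr01 xe.
have [c Gc] := cocycle_primitive a G _ GM GB.
exists c => E rE; apply: rval_density_itv rE => x y x0 xy.
rewrite /Rintegral integral_power//= homG//; last exact: lt_le_trans xy.
rewrite Gc ?ler_pdivlMr ?mul1r// mulrCA power_primitive_scale//.
exact: lt_le_trans xy.
Qed.

Lemma homogeneous_power_density (a : R) nu :
  (forall t E, 0 < t -> relcompact_borel E ->
     cval nu [set t * x | x in E]%R = ((t `^ a)%:C * cval nu E)%C) ->
  exists c, has_power_density nu c (a - 1).
Proof.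
move=> hom.
have [|c1 c1E] := homogeneous_density a (cre nu).
  by move=> t E t0 rE; have := hom t E t0 rE; rewrite /cval; simpc => -[].
have [|c2 c2E] := homogeneous_density a (cim nu).
  by move=> t E t0 rE; have := hom t E t0 rE; rewrite /cval; simpc => -[].
by exists (c1 +i* c2)%C => E rE; rewrite /cval c1E// c2E//; simpc.
Qed.

End homogeneous.

(** * Invariance of the limit set under dilations *)

Section invariance.
Context {R : realType}.

Lemma cvg_real_complex {T : Type} (F : set_system T) {FF : Filter F}
    (f : T -> R) (l : R) :
  f x @[x --> F] --> l ->
  ((f x)%:C%C : R[i]^o) @[x --> F] --> (l%:C%C : R[i]^o).
Proof.
move=> fl; apply/(@cvgrPdist_lt _ R[i]^o) => e.
rewrite ltcE/= => /andP[/eqP e_im e_re].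
move/cvgrPdist_lt : fl => /(_ _ e_re); apply: filterS => x.
by rewrite -rmorphB normc_def/= expr0n addr0 sqrtr_sqr ltcE/= e_im eqxx.
Qed.

Lemma test_function_scale (t : R) (phi : R -> R[i]^o) : 0 < t ->
  test_function phi -> test_function (fun x => phi (t * x)).
Proof.
move=> t0 [cphi [K [cK K0 phiK]]]; split.
  by move=> x; apply: continuous_comp; [exact: mulrl_continuous|exact: cphi].
exists [set t^-1 * x | x in K]%R; split.
- apply: continuous_compact => //; apply: continuous_subspaceT.
  exact: mulrl_continuous.
- move=> _ [x /K0 /= + <-]; rewrite !in_itv/= !andbT => x0.
  by rewrite mulr_gt0// invr_gt0.
- move=> x Kx; apply: phiK => Ktx; apply: Kx; exists (t * x) => //.
  by rewrite mulKf// gt_eqF.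
Qed.

(** Passing from [s] to [t s] amounts to rescaling the test function by [t] and
    replacing the normalisation [V s] by [V (t s)]. *)
Lemma cint_azarin_scale (rho : R -> R) (mu : complexRadon R)
    (t s : {posnum R}) (phi : R -> R[i]^o) : continuous phi ->
  cint (azarin rho mu (t%:num * s%:num)%:pos) phi =
  (growth rho s%:num / growth rho (t%:num * s%:num))%:C%C *
    cint (azarin rho mu s) (fun x => phi (t%:num^-1 * x)).
Proof.
move=> cphi; have s0 : growth rho s%:num != 0 by rewrite gt_eqF ?growth_gt0.
have cpsi : continuous (fun x => phi (t%:num^-1 * x)).
  by move=> x; apply: continuous_comp; [exact: mulrl_continuous|exact: cphi].
rewrite /azarin (cint_dilate _ _ _ _ cphi) (cint_dilate _ _ _ _ cpsi).
rewrite mulrA -rmorphM [_ / _ * _]mulrAC divff// mul1r.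
congr (_ * cint _ _); apply/funext => x.
by rewrite [in LHS]/= invfM -mulrA.
Qed.

(** If [nu] is the limit along [s n], then [nu (t E) / t^rho0] is the limit along
    [t * s n], because [V (s n) / V (t * s n)] tends to [t^(- rho0)]. *)
Lemma Fr_scale (rho : R -> R) (rho0 : R) (mu nu : complexRadon R)
    (t v : {posnum R}) :
  proximate_order rho -> rho r @[r --> +oo] --> rho0 ->
  v%:num = t%:num `^ rho0 ->
  Fr rho mu nu -> Fr rho mu (dilate t v nu).
Proof.
move=> hrho hrho0 vE [s [sy munu]]; have t0 : 0 < t%:num by [].
have t'0 : 0 < t%:num^-1 by [].
exists (fun n => (t%:num * (s n)%:num)%:pos); split.
  exact: (cvg_comp _ _ sy (gt0_cvgMry t0 cvg_id)).
move=> phi tphi.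
have tpsi := test_function_scale _ _ t'0 tphi.
have cphi := tphi.1.
rewrite cint_dilate// vE -powRN.
have := cvg_comp _ _ sy (growth_slowly_varying _ _ t%:num hrho hrho0 t0).
move=> /cvg_real_complex ratio.
have h := cvgM ratio (munu _ tpsi).
have -> : (fun n => cint (azarin rho mu (t%:num * (s n)%:num)%:pos) phi : R[i]^o) =
  (fun n => (growth rho (s n)%:num / growth rho (t%:num * (s n)%:num))%:C%C *
     cint (azarin rho mu (s n)) (fun x => phi (t%:num^-1 * x))).
  by apply/funext => n; exact: cint_azarin_scale.
exact: (h _).
Qed.

End invariance.

Theorem theorem3p17 (R : realType) (rho : R -> R) (rho0 : R)
    (hrho : proximate_order rho) (hrho0 : rho r @[r --> +oo] --> rho0)
    (mu nu : complexRadon R)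
    (hmu : M_infty rho mu)
    (hreg : regular rho mu)
    (hFr : is_radon_singleton (Fr rho mu) nu) :
  exists c : R[i], has_power_density nu c (rho0 - 1).
Proof.
have [Frnu nu_uniq] := hFr.
apply: homogeneous_power_density => t E t0 rE.
have v0 : 0 < t `^ rho0 by exact: powR_gt0.
have := nu_uniq _ (Fr_scale _ _ _ _ (PosNum t0) (PosNum v0) hrho hrho0 erefl Frnu).
move=> /(_ _ rE); rewrite cval_dilate/= => <-.
by rewrite mulrA -rmorphM/= divff ?mul1r// gt_eqF.
Qed.
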